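(* Let $(M,g,I,J,K)$ be a hyperkähler manifold, let $X$ be any vector field on $M$ (not necessarily Killing), and let $\alpha = i_X\omega_I$. Suppose there are 2-forms $F_1,F_2$ on $M$, each of type $(1,1)$ with respect to each of the complex structures $I,J,K$, such that $$\mathcal L_X\omega_I = 0,\qquad \mathcal L_X\omega_J = -\omega_K - F_2,\qquad \mathcal L_X\omega_K = \omega_J + F_1 .$$ These equations are equivalent to $$d\alpha = 0,\qquad d(J\alpha) = \omega_J + F_1,\qquad d(K\alpha) = \omega_K + F_2 .$$ Then the 2-form $\omega_I - d(I\alpha)$ is of type $(1,1)$ with respect to each of the complex structures.
   Context: Conventions: $IJ=K$; the Kähler forms are $\omega_I(v,w)=g(Iv,w)$, $\omega_J(v,w)=g(Jv,w)$, $\omega_K(v,w)=g(Kv,w)$. For a 1-form $\alpha$, $(I\alpha)(v)=\alpha(Iv)$, and similarly for $J\alpha$, $K\alpha$. A (real) 2-form $F$ is of type $(1,1)$ with respect to a complex structure $L$ if $F(Lv,Lw)=F(v,w)$ for all $v,w$. $\mathcal L_X$ is the Lie derivative and $i_X$ is the interior product. *)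

(* Defs.v *)
From HB Require Import structures.
From mathcomp Require Import all_boot all_order all_algebra.
From mathcomp Require Import ring.
From mathcomp Require Import all_classical all_reals all_analysis.

Set Implicit Arguments.
Unset Strict Implicit.
Unset Printing Implicit Defensive.
Import Order.TTheory GRing.Theory Num.Theory.
Import numFieldNormedType.Exports.
Local Open Scope classical_set_scope.
Local Open Scope ring_scope.

Section Ck.
Context {R : realType} {n : nat}.

(* C^k on the open set U: iterated partial derivatives up to order k exist and
   are continuous on U. *)
Fixpoint Ck {W : normedModType R} (k : nat) (U : set 'rV[R]_n)
    (f : 'rV[R]_n -> W) : Prop :=
  (forall x, U x -> {for x, continuous f}) /\
  match k with
  | 0%N => True
  | k'.+1 => forall i : 'I_n,
      (forall x, U x -> derivable f x (delta_mx 0 i)) /\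
      Ck k' U ('D_(delta_mx 0 i) f)
  end.

Definition smooth_on {W : normedModType R} (U : set 'rV[R]_n)
    (f : 'rV[R]_n -> W) : Prop := forall k, Ck k U f.

Lemma CkS {W : normedModType R} k (U : set 'rV[R]_n) (f : 'rV[R]_n -> W) :
  Ck k.+1 U f -> Ck k U f.
Proof.
elim: k f => [|k IH] f [cf df]; first by split.
split=> // i; by have [df1 df2] := df i; split=> //; exact: IH.
Qed.

Lemma eq_Ck {W : normedModType R} k (U : set 'rV[R]_n) (f g : 'rV[R]_n -> W) :
  open U -> (forall x, U x -> f x = g x) -> Ck k U f -> Ck k U g.
Proof.
move=> oU; elim: k f g => [|k IH] f g fg [cf df].
  split=> // x Ux.
  have nfg : \forall y \near x, f y = g y.
    by apply: filterS (open_nbhs_nbhs (conj oU Ux)) => y; exact: fg.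
  have := cf x Ux; rewrite /prop_for /continuous_at -(fg x Ux).
  by move=> h; apply: cvg_trans h; exact: (near_eq_cvg nfg).
have nfg x : U x -> \forall y \near x, f y = g y.
  by move=> Ux; apply: filterS (open_nbhs_nbhs (conj oU Ux)) => y; exact: fg.
split=> [x Ux|i].
  have := cf x Ux; rewrite /prop_for /continuous_at -(fg x Ux).
  by move=> h; apply: cvg_trans h; exact: (near_eq_cvg (nfg x Ux)).
have [df1 df2] := df i; split=> [x Ux|].
  exact: near_eq_derivable (nfg x Ux) (df1 x Ux).
apply: IH df2 => x Ux; exact: near_eq_derive (nfg x Ux).
Qed.

Lemma Ck_cst {W : normedModType R} k (U : set 'rV[R]_n) (c : W) :
  Ck k U (cst c).
Proof.
elim: k c => [|k IH] c; first by split=> // x _; exact: cst_continuous.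
split=> [x _|i]; first exact: cst_continuous.
split=> [x _|]; first exact: derivable_cst.
have -> : 'D_(delta_mx 0 i) (cst c) = cst 0 :> ('rV[R]_n -> W).
  by apply/funext => x; rewrite derive_cst.
exact: IH.
Qed.

Lemma CkD {W : normedModType R} k (U : set 'rV[R]_n) (f g : 'rV[R]_n -> W) :
  open U -> Ck k U f -> Ck k U g -> Ck k U (f + g).
Proof.
move=> oU; elim: k f g => [|k IH] f g [cf df] [cg dg].
  by split=> // x Ux; apply: continuousD; [exact: cf|exact: cg].
split=> [x Ux|i]; first by apply: continuousD; [exact: cf|exact: cg].
have [df1 df2] := df i; have [dg1 dg2] := dg i; split=> [x Ux|].
  by apply: derivableD; [exact: df1|exact: dg1].
apply: eq_Ck (IH _ _ df2 dg2) => // x Ux.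
by rewrite deriveD; [|exact: df1|exact: dg1].
Qed.

Lemma CkM k (U : set 'rV[R]_n) (f g : 'rV[R]_n -> R^o) :
  open U -> Ck k U f -> Ck k U g -> Ck k U (f * g).
Proof.
move=> oU; elim: k f g => [|k IH] f g Cf Cg;
  have [cf df] := Cf; have [cg dg] := Cg.
  by split=> // x Ux; apply: continuousM; [exact: cf|exact: cg].
split=> [x Ux|i]; first by apply: continuousM; [exact: cf|exact: cg].
have [df1 df2] := df i; have [dg1 dg2] := dg i; split=> [x Ux|].
  by apply: derivableM; [exact: df1|exact: dg1].
apply: eq_Ck (CkD oU (IH _ _ (CkS Cf) dg2) (IH _ _ (CkS Cg) df2)) => // x Ux.
by rewrite deriveM; [|exact: df1|exact: dg1].
Qed.

End Ck.

Record chart (R : realType) (n : nat) (M : topologicalType) := Chart {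
  chart_dom : set M ;
  chart_img : set 'rV[R]_n ;
  chart_fun : M -> 'rV[R]_n ;
  chart_inv : 'rV[R]_n -> M ;
  chart_dom_open : open chart_dom ;
  chart_img_open : open chart_img ;
  chart_funP : forall p, chart_dom p -> chart_img (chart_fun p) ;
  chart_invP : forall x, chart_img x -> chart_dom (chart_inv x) ;
  chart_funK : forall p, chart_dom p -> chart_inv (chart_fun p) = p ;
  chart_invK : forall x, chart_img x -> chart_fun (chart_inv x) = x ;
  chart_fun_continuous :
    forall p, chart_dom p -> {for p, continuous chart_fun} ;
  chart_inv_continuous :
    forall x, chart_img x -> {for x, continuous chart_inv} }.

(* The atlas is not required to be maximal: C^oo(M) only depends on the
   maximal atlas containing it. *)
Record manifold (R : realType) (n : nat) := Manifold {
  man_sort :> topologicalType ;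
  man_hausdorff : hausdorff_space man_sort ;
  man_second_countable : @second_countable man_sort ;
  atlas : set (chart R n man_sort) ;
  atlas_cover : forall p, exists2 c, atlas c & chart_dom c p ;
  atlas_compat : forall c c', atlas c -> atlas c' ->
    smooth_on (chart_img c `&` chart_inv c @^-1` chart_dom c')
              (chart_fun c' \o chart_inv c) }.

Arguments atlas {R n} m.

Section Cinf.
Context {R : realType} {n : nat} (M : manifold R n).

Definition smooth (f : M -> R^o) : Prop :=
  forall c, atlas M c -> smooth_on (chart_img c) (f \o chart_inv c).

Definition smooth_pred : {pred M -> R^o} := fun f => `[< smooth f >].

Lemma smooth_cst (a : R^o) : smooth (cst a).
Proof. by move=> c _ k; exact: Ck_cst. Qed.

Lemma smoothD (f g : M -> R^o) : smooth f -> smooth g -> smooth (f + g).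
Proof.
by move=> sf sg c Ac k; apply: CkD (sf c Ac k) (sg c Ac k);
   exact: chart_img_open.
Qed.

Lemma smoothM (f g : M -> R^o) : smooth f -> smooth g -> smooth (f * g).
Proof.
by move=> sf sg c Ac k; apply: CkM (sf c Ac k) (sg c Ac k);
   exact: chart_img_open.
Qed.

Lemma smooth_scaler_closed : scaler_closed smooth_pred.
Proof.
move=> a f /asboolP sf; apply/asboolP.
exact: smoothM (smooth_cst a) sf.
Qed.

Lemma smooth_subring_closed : subring_closed smooth_pred.
Proof.
split=> [|f g /asboolP sf /asboolP sg|f g /asboolP sf /asboolP sg];
  apply/asboolP; [exact: smooth_cst| |exact: smoothM].
have -> : f - g = f + cst (-1) * g.
  by apply/funext => x; rewrite !fctE mulN1r.
exact: smoothD sf (smoothM (smooth_cst (-1)) sg).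
Qed.

HB.instance Definition _ :=
  GRing.isSubringClosed.Build _ smooth_pred smooth_subring_closed.
HB.instance Definition _ :=
  GRing.isScaleClosed.Build R _ smooth_pred smooth_scaler_closed.

Record Cinf := MkCinf { Cinf_fun :> M -> R^o ; _ : smooth_pred Cinf_fun }.

HB.instance Definition _ := [isSub for Cinf_fun].
HB.instance Definition _ := [Choice of Cinf by <:].
HB.instance Definition _ := 
  GRing.SubChoice_isSubComPzRing.Build _ _ Cinf (subringClosedP smooth_pred).
HB.instance Definition _ := [SubZmodule_isSubLmodule of Cinf by <:].

Lemma Cinf_scalerAl (a : R) (f h : Cinf) : a *: (f * h) = (a *: f) * h.
Proof. by apply/val_inj/funext => p /=; rewrite !fctE/= scalerAl. Qed.

Lemma Cinf_scalerAr (a : R) (f h : Cinf) : a *: (f * h) = f * (a *: h).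
Proof. by rewrite mulrC Cinf_scalerAl mulrC. Qed.

End Cinf.

(* Vector fields are the R-linear derivations of C^oo(M); tensor fields are the
   C^oo(M)-multilinear maps on vector fields. *)
Section vfield.
Context {R : realType} {n : nat} (M : manifold R n).
Local Notation C := (Cinf M).

Definition derivation (D : C -> C) : Prop :=
  linear D /\ forall f h, D (f * h) = D f * h + f * D h.

Definition derivation_pred : {pred C -> C} := fun D => `[< derivation D >].

Lemma derivation_zmod_closed : zmod_closed derivation_pred.
Proof.
split=> [|D E /asboolP[Dl DM] /asboolP[El EM]]; apply/asboolP; split.
- by move=> a f h; rewrite -[RHS]/(a *: (0 : C) + 0) scaler0 addr0.
- by move=> f h; rewrite -[RHS]/(0 * h + f * 0) mul0r mulr0 addr0.
- move=> a f h; rewrite -[LHS]/(D (a *: f + h) - E (a *: f + h)).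
  by rewrite Dl El opprD addrACA -scalerBr.
- move=> f h; rewrite -[LHS]/(D (f * h) - E (f * h)).
  rewrite -[RHS]/((D f - E f) * h + f * (D h - E h)) DM EM.
  by rewrite mulrBl mulrBr opprD addrACA.
Qed.

HB.instance Definition _ :=
  GRing.isZmodClosed.Build _ derivation_pred derivation_zmod_closed.

Record vfield := MkVfield {
  vfield_fun :> C -> C ; vfield_subproof : derivation_pred vfield_fun }.

HB.instance Definition _ := [isSub for vfield_fun].
HB.instance Definition _ := [Choice of vfield by <:].
HB.instance Definition _ := [SubChoice_isSubZmodule of vfield by <:].

Lemma vfieldL (V : vfield) : linear V.
Proof. by have /asboolP[] := vfield_subproof V. Qed.

HB.instance Definition _ (V : vfield) :=
  GRing.isLinear.Build R C C *:%R V (vfieldL V).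

Lemma vfieldM (V : vfield) (f h : C) : V (f * h) = V f * h + f * V h.
Proof. by have /asboolP[_] := vfield_subproof V. Qed.

Lemma vfieldDE (V W : vfield) f : (V + W) f = V f + W f.
Proof. by []. Qed.

Lemma vfieldNE (V : vfield) f : (- V) f = - V f.
Proof. by []. Qed.

Lemma vscale_subproof (f : C) (V : vfield) :
  derivation_pred (fun h : C => f * V h).
Proof.
apply/asboolP; split=> [a u v|u v].
  by rewrite linearP mulrDr -Cinf_scalerAr.
by rewrite vfieldM mulrDr mulrA mulrCA.
Qed.

Definition vscale (f : C) (V : vfield) : vfield :=
  MkVfield (vscale_subproof f V).

Lemma vscaleA f h V : vscale f (vscale h V) = vscale (f * h) V.
Proof. by apply/val_inj/funext => u /=; rewrite mulrA. Qed.
Lemma vscale1 : left_id 1 vscale.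
Proof. by move=> V; apply/val_inj/funext => u /=; rewrite mul1r. Qed.
Lemma vscaleDr : right_distributive vscale +%R.
Proof. by move=> f V W; apply/val_inj/funext => u /=; rewrite !fctE mulrDr. Qed.
Lemma vscaleDl V : {morph vscale^~ V : f h / f + h}.
Proof. by move=> f h; apply/val_inj/funext => u /=; rewrite !fctE mulrDl. Qed.

HB.instance Definition _ := GRing.Zmodule_isLmodule.Build C vfield
  vscaleA vscale1 vscaleDr vscaleDl.

Lemma vfieldZE f (V : vfield) h : (f *: V) h = f * V h.
Proof. by []. Qed.

Lemma lbracket_subproof (V W : vfield) :
  derivation_pred (fun f : C => V (W f) - W (V f)).
Proof.
apply/asboolP; split=> [a f h|f h].
  by rewrite (vfieldL W) (vfieldL V) (vfieldL V) (vfieldL W) opprD addrACA -scalerBr.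
by rewrite !vfieldM !linearD /= !vfieldM; ring.
Qed.

Definition lbracket (V W : vfield) : vfield := MkVfield (lbracket_subproof V W).

Lemma vfield_eqP (V W : vfield) : (forall f, V f = W f) -> V = W.
Proof. by move=> VW; apply/val_inj/funext. Qed.

Lemma lbracketC V W : lbracket V W = - lbracket W V.
Proof. by apply: vfield_eqP => f; rewrite vfieldNE /= opprB. Qed.

Lemma lbracketDl U V W : lbracket (U + V) W = lbracket U W + lbracket V W.
Proof.
by apply: vfield_eqP => f; rewrite vfieldDE /= !fctE linearD /=; ring.
Qed.

Lemma lbracketZl f V W : lbracket (f *: V) W = f *: lbracket V W - W f *: V.
Proof.
apply: vfield_eqP => h.
by rewrite vfieldDE vfieldNE !vfieldZE /= vfieldM; ring.
Qed.

Lemma lbracketZr f V W : lbracket V (f *: W) = f *: lbracket V W + V f *: W.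
Proof.
apply: vfield_eqP => h.
by rewrite vfieldDE !vfieldZE /= vfieldM; ring.
Qed.

Lemma lbracketDr U V W : lbracket U (V + W) = lbracket U V + lbracket U W.
Proof.
by apply: vfield_eqP => f; rewrite vfieldDE /= !fctE linearD /=; ring.
Qed.

End vfield.

Section forms.
Context {R : realType} {n : nat} (M : manifold R n).
Local Notation C := (Cinf M).
Local Notation X := (vfield M).

Definition form1 := {scalar X}.

(* Linearity in the second argument follows by antisymmetry. *)
Definition form2_axiom (F : X -> X -> C) : Prop :=
  (forall W, scalar (F^~ W)) /\ forall V W, F V W = - F W V.

Definition form2_pred : {pred X -> X -> C} := fun F => `[< form2_axiom F >].

Lemma form2_zmod_closed : zmod_closed form2_pred.
Proof.
split=> [|F G /asboolP[Fl Fa] /asboolP[Gl Ga]]; apply/asboolP; split.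
- by move=> W f U V; rewrite -[RHS]/(f * 0 + 0) mulr0 addr0.
- by move=> V W; rewrite -[RHS]/(- 0) oppr0.
- move=> W f U V.
  rewrite -[LHS]/(F (f *: U + V) W - G (f *: U + V) W).
  rewrite -[RHS]/(f * (F U W - G U W) + (F V W - G V W)).
  by rewrite (Fl W) (Gl W); ring.
- move=> V W; rewrite -[LHS]/(F V W - G V W) -[RHS]/(- (F W V - G W V)).
  by rewrite (Fa V) (Ga V); ring.
Qed.

HB.instance Definition _ :=
  GRing.isZmodClosed.Build _ form2_pred form2_zmod_closed.

Record form2 := MkForm2 {
  form2_fun :> X -> X -> C ; form2_subproof : form2_pred form2_fun }.

HB.instance Definition _ := [isSub for form2_fun].
HB.instance Definition _ := [Choice of form2 by <:].
HB.instance Definition _ := [SubChoice_isSubZmodule of form2 by <:].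

Implicit Types (F : form2) (f : C) (U V W : X).

Lemma form2C F V W : F V W = - F W V.
Proof. by have /asboolP[_] := form2_subproof F. Qed.

Lemma form2Pl F f U V W : F (f *: U + V) W = f * F U W + F V W.
Proof. by have /asboolP[Fl _] := form2_subproof F; exact: (Fl W). Qed.

Lemma form2Pr F f U V W : F W (f *: U + V) = f * F W U + F W V.
Proof. by rewrite form2C form2Pl (form2C _ W) (form2C _ W V); ring. Qed.

Lemma form2Dl F U V W : F (U + V) W = F U W + F V W.
Proof. by rewrite -[U]scale1r form2Pl mul1r scale1r. Qed.

Lemma form2Dr F U V W : F W (U + V) = F W U + F W V.
Proof. by rewrite -[U]scale1r form2Pr mul1r scale1r. Qed.

Lemma form20l F W : F 0 W = 0.
Proof. by apply: (addIr (F 0 W)); rewrite -form2Dl !add0r. Qed.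

Lemma form2Zl F f V W : F (f *: V) W = f * F V W.
Proof. by rewrite -[f *: V]addr0 form2Pl form20l addr0. Qed.

Lemma form2Zr F f V W : F V (f *: W) = f * F V W.
Proof. by rewrite form2C form2Zl (form2C _ V); ring. Qed.

Lemma form2_eqP F (G : form2) : (forall V W, F V W = G V W) -> F = G.
Proof. by move=> FG; apply/val_inj/funext => V; exact/funext/FG. Qed.

Lemma form2DE F (G : form2) V W : (F + G) V W = F V W + G V W.
Proof. by []. Qed.

Lemma form2NE F V W : (- F) V W = - F V W.
Proof. by []. Qed.

Definition iprod V F : X -> C := F V.

Lemma iprod_subproof V F : scalar (iprod V F).
Proof. by move=> f U W; rewrite /iprod form2Pr. Qed.

HB.instance Definition _ V F :=
  GRing.isLinear.Build C X C *%R (iprod V F) (iprod_subproof V F).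

(* twist L a is the 1-form L a : V |-> a (L V). *)
Definition twist (L : {linear X -> X}) (a : form1) : X -> C :=
  fun V => a (L V).

Lemma twist_subproof L a : scalar (twist L a).
Proof. by move=> f U W; rewrite /twist !linearP. Qed.

HB.instance Definition _ L a :=
  GRing.isLinear.Build C X C *%R (twist L a) (twist_subproof L a).

(* Exterior derivatives of 1- and 2-forms by Koszul's invariant formula,
   normalized without the factors 1/2 and 1/3, so that Cartan's formula
   L_X = d i_X + i_X d holds with (i_X F) V = F X V. *)
Lemma extd1_subproof (a : form1) : form2_pred (fun V W : X =>
  V (a W) - W (a V) - a (lbracket V W)).
Proof.
apply/asboolP; split=> [W f U V|V W].
  rewrite vfieldDE vfieldZE lbracketDl lbracketZl !linearD linearN !linearZ.
  by rewrite /= vfieldM; ring.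
by rewrite (lbracketC V) linearN; ring.
Qed.

Definition extd1 (a : form1) : form2 := MkForm2 (extd1_subproof a).

Definition extd2 (F : X -> X -> C) : X -> X -> X -> C := fun U V W =>
  U (F V W) - V (F U W) + W (F U V)
  - F (lbracket U V) W + F (lbracket U W) V - F (lbracket V W) U.

(* L_Z F, from the Leibniz rule for the contraction F V W and
   L_Z V = lbracket Z V. *)
Lemma lie_derivative_subproof (Z : X) F : form2_pred (fun V W : X =>
  Z (F V W) - F (lbracket Z V) W - F V (lbracket Z W)).
Proof.
apply/asboolP; split=> [W f U V|V W].
  rewrite !form2Pl lbracketDr lbracketZr !form2Dl !form2Zl linearD/= vfieldM.
  by ring.
rewrite (form2C _ V W) (form2C _ (lbracket Z V)) (form2C _ V) linearN/=.
by ring.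
Qed.

Definition lie_derivative (Z : X) F : form2 :=
  MkForm2 (lie_derivative_subproof Z F).

Definition type11 (L : X -> X) F : Prop :=
  forall V W, F (L V) (L W) = F V W.

End forms.

Section hyperkahler.
Context {R : realType} {n : nat} (M : manifold R n).
Local Notation C := (Cinf M).
Local Notation X := (vfield M).

(* Two vector fields agree at p iff they have the same action on smooth
   functions at p, so positive definiteness is required exactly where
   V does not vanish. *)
Record riemannian := Riemannian {
  riem :> X -> X -> C ;
  riem_linear : forall W, scalar (riem^~ W) ;
  riem_sym : forall V W, riem V W = riem W V ;
  riem_pos : forall (V : X) (p : M),
    (exists f : C, V f p != 0) -> 0 < riem V V p }.

Definition nijenhuis (L : X -> X) (V W : X) : X :=
  lbracket (L V) (L W) - L (lbracket (L V) W) - L (lbracket V (L W))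
  - lbracket V W.

(* An integrable almost complex structure L with respect to which g is
   Hermitian and whose Kaehler form g(L., .) is closed. *)
Record kahler (g : riemannian) := Kahler {
  kahler_op :> {linear X -> X} ;
  kahler_sqr : forall V, kahler_op (kahler_op V) = - V ;
  kahler_integrable : forall V W, nijenhuis kahler_op V W = 0 ;
  kahler_isometry : forall V W, g (kahler_op V) (kahler_op W) = g V W ;
  kahler_closed : forall U V W,
    extd2 (fun V W => g (kahler_op V) W) U V W = 0 }.

Lemma kahler_form_subproof (g : riemannian) (L : kahler g) :
  form2_pred (fun V W : X => g (L V) W).
Proof.
apply/asboolP; split=> [W f U V|V W]; first by rewrite linearP riem_linear.
have gN V' W' : g (- V') W' = - g V' W'.
  rewrite -[- V']addr0 -scaleN1r riem_linear mulN1r.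
  suff -> : g 0 W' = 0 by rewrite addr0.
  by apply: (addIr (g 0 W')); rewrite -{1}[g 0 W']mul1r -riem_linear
    scale1r !add0r.
by rewrite -(kahler_isometry L) kahler_sqr gN riem_sym.
Qed.

Definition kahler_form (g : riemannian) (L : kahler g) : form2 M :=
  MkForm2 (kahler_form_subproof L).

(* I^2 = J^2 = K^2 = -1 together with IJ = K gives all the quaternion
   relations. *)
Record hyperkahler := Hyperkahler {
  hk_metric :> riemannian ;
  hkI : kahler hk_metric ;
  hkJ : kahler hk_metric ;
  hkK : kahler hk_metric ;
  hk_IJ : forall V, hkI (hkJ V) = hkK V }.

End hyperkahler.

(* Main.v *)
Require Import Defs.
From HB Require Import structures.
From mathcomp Require Import all_boot all_order all_algebra ring.
From mathcomp Require Import all_classical all_reals all_analysis.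

(** Since each Kaehler form is closed, Cartan's formula turns [L_X omega_L]
    into [d (i_X omega_L)] ([lie_derivative_extd1]).  The quaternion relations
    give [J alpha = i_X omega_K] and [K alpha = - i_X omega_J], so the two
    systems of equations are the same system.

    The second claim comes from integrability.  An integrable [L] relates the
    exterior derivatives of a 1-form [a] and of [L a]
    ([extd1_twist_integrable]):
      [da(LV, LW) - da(V, W) = d(La)(LV, W) + d(La)(V, LW)].
    For [a = alpha] and [L = I] the left-hand side is 0, so [d(I alpha)]
    is of type (1,1) for [I], as [omega_I] is.  For [a = I alpha] and [L = J],
    where [L a = K alpha], it says that [d(I alpha)(J., J.) - d(I alpha)] is
    the derivation-like action of [J] on [omega_K + F2].  That action kills
    the (1,1)-form [F2] and sends [omega_K] to [- 2 omega_I].  As [omega_I] is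
    of type (2,0)+(0,2) for [J], the difference [omega_I(J., J.) - omega_I] is
    also [- 2 omega_I], so [omega_I - d(I alpha)] is of type (1,1) for [J],
    and then for [K = IJ]. *)

Set Implicit Arguments.
Unset Strict Implicit.
Unset Printing Implicit Defensive.
Import GRing.Theory.
Local Open Scope ring_scope.

Section ExteriorDerivative.
Context {R : realType} {n : nat} {M : manifold R n}.
Implicit Types (V W X : vfield M) (a b : form1 M) (F : form2 M).

Lemma eq_extd1 a b : a =1 b -> extd1 a = extd1 b.
Proof. by move=> ab; apply: form2_eqP => V W /=; rewrite !ab. Qed.

Lemma extd1_opp a b : (forall V, a V = - b V) -> extd1 a = - extd1 b.
Proof.
move=> ab; apply: form2_eqP => V W; rewrite form2NE /= !ab !linearN /=.
by ring.
Qed.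

(** Cartan's formula [L_X F = d (i_X F) + i_X dF] for a closed form. *)
Lemma lie_derivative_extd1 X F :
  (forall U V W, extd2 F U V W = 0) ->
  lie_derivative X F = extd1 (iprod X F).
Proof.
move=> dF; apply: form2_eqP => V W; have := dF X V W.
rewrite /extd2 /= /iprod (form2C F (lbracket X W)) (form2C F (lbracket V W)).
by move=> dFXVW; apply/eqP; rewrite -subr_eq0 -dFXVW; apply/eqP; ring.
Qed.

(** Up to sign, the difference of the two sides is [a] evaluated on the
    Nijenhuis tensor of [L], since the terms that differentiate values of [a] cancel. *)
Lemma extd1_twist_integrable (L : {linear vfield M -> vfield M}) a V W :
  (forall U, L (L U) = - U) -> nijenhuis L V W = 0 ->
  extd1 a (L V) (L W) - extd1 a V W =
  extd1 (twist L a) (L V) W + extd1 (twist L a) V (L W).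
Proof.
move=> LL NL; have := congr1 a NL; rewrite /nijenhuis !linearB linear0 /=.
rewrite /twist !LL !linearN /= => aN.
by apply/eqP; rewrite -subr_eq0 -oppr_eq0 -aN; apply/eqP; ring.
Qed.

(** For [L ^ 2 = -1], being of type (1,1) means that [L] acts trivially on the
    form as a derivation. *)
Lemma type11_skew (L : vfield M -> vfield M) F :
  (forall U, L (L U) = - U) ->
  type11 L F <-> forall V W, F (L V) W + F V (L W) = 0.
Proof.
have FN V W : F V (- W) = - F V W by rewrite -scaleN1r form2Zr mulN1r.
move=> LL; split=> h V W.
  by rewrite -(h V (L W)) LL FN subrr.
by apply/eqP; rewrite -subr_eq0 -(h V (L W)) LL FN.
Qed.

End ExteriorDerivative.

Section Hyperkahler.
Context {R : realType} {n : nat} {M : manifold R n}.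
Implicit Types (U V W X : vfield M) (F : form2 M).

Lemma riemNl (g : riemannian M) V W : g (- V) W = - g V W.
Proof.
have gP f U U' : g (f *: U + U') W = f * g U W + g U' W.
  exact: (riem_linear g W f).
have g0 : g 0 W = 0.
  by apply: (addIr (g 0 W)); rewrite -{1}[g 0 W]mul1r -gP scale1r !add0r.
by rewrite -[- V]addr0 -scaleN1r gP g0 mulN1r addr0.
Qed.

Lemma kahler_skew (g : riemannian M) (L : kahler g) V W :
  g V (L W) = - g (L V) W.
Proof. by rewrite riem_sym; exact: (form2C (kahler_form L)). Qed.

Lemma type11_kahler_form (g : riemannian M) (L : kahler g) :
  type11 L (kahler_form L).
Proof. by move=> V W; exact: kahler_isometry. Qed.

Context (H : hyperkahler M).
Local Notation I := (hkI H).
Local Notation J := (hkJ H).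
Local Notation K := (hkK H).

Lemma hk_KJ V : K (J V) = - I V.
Proof. by rewrite -hk_IJ kahler_sqr linearN. Qed.

Lemma hk_JK V : J (K V) = I V.
Proof.
have : I (I (J (K V))) = - I V by rewrite hk_IJ kahler_sqr linearN.
by rewrite kahler_sqr => /oppr_inj.
Qed.

Lemma hk_JI V : J (I V) = - K V.
Proof. by rewrite -hk_JK kahler_sqr. Qed.

Lemma hk_KI V : K (I V) = J V.
Proof. by rewrite -hk_IJ hk_JI linearN /= -hk_IJ kahler_sqr opprK. Qed.

Lemma twistJ_iprod X :
  twist J (iprod X (kahler_form I)) =1 iprod X (kahler_form K).
Proof.
by move=> V; rewrite /twist /iprod /= kahler_skew hk_JI riemNl opprK.
Qed.

Lemma twistK_iprod X V :
  twist K (iprod X (kahler_form I)) V = - iprod X (kahler_form J) V.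
Proof. by rewrite /twist /iprod /= kahler_skew hk_KI. Qed.

Lemma kahler_form_IJ V W :
  kahler_form I (J V) (J W) = - kahler_form I V W.
Proof. by rewrite /= kahler_skew hk_IJ hk_JK. Qed.

(** [J] acts as a derivation on the span of the Kaehler forms through the
    commutator, here [KJ - JK = - 2 I]. *)
Lemma kahler_form_KJ V W :
  kahler_form K (J V) W + kahler_form K V (J W) = - (kahler_form I V W *+ 2).
Proof. by rewrite /= kahler_skew hk_KJ hk_JK riemNl mulr2n opprD. Qed.

Lemma type11_hkK F : type11 I F -> type11 J F -> type11 K F.
Proof. by move=> FI FJ V W; rewrite -!hk_IJ FI FJ. Qed.

Lemma lie_derivative_kahler (L : kahler H) X :
  lie_derivative X (kahler_form L) = extd1 (iprod X (kahler_form L)).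
Proof. by apply: lie_derivative_extd1; exact: kahler_closed. Qed.

Lemma lie_equations_extd1 X (F1 F2 : form2 M) :
  let alpha : form1 M := iprod X (kahler_form I) in
  [/\ lie_derivative X (kahler_form I) = 0,
      lie_derivative X (kahler_form J) = - kahler_form K - F2 &
      lie_derivative X (kahler_form K) = kahler_form J + F1] <->
  [/\ extd1 alpha = 0,
      extd1 (twist J alpha) = kahler_form J + F1 &
      extd1 (twist K alpha) = kahler_form K + F2].
Proof.
move=> alpha; rewrite !lie_derivative_kahler.
rewrite (eq_extd1 (twistJ_iprod X)) (extd1_opp (twistK_iprod X)).
split=> -[dI dJ dK]; split=> //; first by rewrite dJ -opprD opprK.
by rewrite -opprD -dK opprK.
Qed.

(** With [d alpha = 0], [extd1_twist_integrable] at [a = alpha] says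
    that [I] acts trivially on [d(I alpha)] as a derivation. *)
Lemma type11_extd1_twistI X :
  let alpha : form1 M := iprod X (kahler_form I) in
  extd1 alpha = 0 -> type11 I (extd1 (twist I alpha)).
Proof.
move=> alpha dalpha; apply/type11_skew => [U|V W]; first exact: kahler_sqr.
rewrite -extd1_twist_integrable ?dalpha ?subrr //; first exact: kahler_sqr.
exact: kahler_integrable.
Qed.

(** Integrability of [J], applied to [I alpha]: since [J(I alpha) = K alpha],
    the failure of [d(I alpha)] to be of type (1,1) for [J] is read off from
    the prescribed value of [d(K alpha)], where only [omega_K] contributes. *)
Lemma extd1_twistI_J X (F2 : form2 M) V W :
  let alpha : form1 M := iprod X (kahler_form I) in
  let theta := extd1 (twist I alpha) in
  type11 J F2 -> extd1 (twist K alpha) = kahler_form K + F2 ->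
  theta (J V) (J W) - theta V W = - (kahler_form I V W *+ 2).
Proof.
move=> alpha theta FJ dK.
have JJ U : J (J U) = - U by exact: kahler_sqr.
rewrite (extd1_twist_integrable _ JJ) ?kahler_integrable //.
have -> : extd1 (twist J (twist I alpha)) = kahler_form K + F2.
  by rewrite -dK; apply: eq_extd1 => U; rewrite /twist /= hk_IJ.
rewrite !form2DE addrACA kahler_form_KJ.
by have /(type11_skew _ JJ) -> := FJ; rewrite addr0.
Qed.

End Hyperkahler.

Theorem theorem2 (R : realType) (n : nat) (M : manifold R n)
    (H : hyperkahler M) (X : vfield M) (F1 F2 : form2 M) :
  let I := hkI H in
  let J := hkJ H in
  let K := hkK H in
  let omega_I := kahler_form I in
  let omega_J := kahler_form J in
  let omega_K := kahler_form K in
  let alpha : form1 M := iprod X omega_I in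
  let type11_IJK F := [/\ type11 I F, type11 J F & type11 K F] in
  let lie_equations :=
    [/\ lie_derivative X omega_I = 0,
        lie_derivative X omega_J = - omega_K - F2 &
        lie_derivative X omega_K = omega_J + F1] in
  let ext_equations :=
    [/\ extd1 alpha = 0,
        extd1 (twist J alpha) = omega_J + F1 &
        extd1 (twist K alpha) = omega_K + F2] in
  type11_IJK F1 -> type11_IJK F2 ->
  (lie_equations <-> ext_equations) /\
  (lie_equations -> type11_IJK (omega_I - extd1 (twist I alpha))).
Proof.
move=> I J K omega_I omega_J omega_K alpha type11_IJK lie_eqs ext_eqs.
move=> _ [_ F2J _].
have lie_ext : lie_eqs <-> ext_eqs by exact: lie_equations_extd1.
split=> // /lie_ext[dalpha _ dK].
set theta := extd1 (twist I alpha).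
have type11I : type11 I (omega_I - theta).
  move=> V W; rewrite !form2DE !form2NE type11_kahler_form.
  by rewrite (type11_extd1_twistI dalpha).
have type11J : type11 J (omega_I - theta).
  move=> V W; rewrite !form2DE !form2NE kahler_form_IJ.
  have thetaJ := extd1_twistI_J V W F2J dK.
  rewrite -[theta (J V) (J W)](subrK (theta V W)) thetaJ -/omega_I.
  by rewrite mulr2n; ring.
by split=> //; exact: type11_hkK.
Qed.
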